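(* For every integer $n\ge 1$ the following identities hold: (i) $\sum_{m=1}^{n-1}m^3 \sigma(m)\sigma(n-m) = \frac{1}{12}n^3\sigma_3(n) - \frac{1}{24}n^3(3n-1)\sigma(n)$; (ii) $\sum_{m=1}^{n-1}m^2 \sigma(m)\sigma(n-m) = \frac{1}{8}n^2\sigma_3(n) - \frac{1}{24}n^2(4n-1)\sigma(n)$; (iii) $\sum_{m=1}^{n-1}m \sigma(m)\sigma(n-m) = \frac{1}{24}n(1 -6n)\sigma(n) + \frac{5}{24}n\sigma_3(n)$; (iv) $\sum^{n-1}_{m=1}m^2\sigma(m)\sigma_3(n-m) = - \frac{1}{240}n^2\sigma(n)-\frac{1}{120}n^3\sigma_3(n)+ \frac{1}{80}n^2\sigma_5(n)$; (v) $\sum^{n-1}_{m=1}m\sigma(m)\sigma_3(n-m) = - \frac{1}{240}n\sigma(n)-\frac{1}{40}n^2\sigma_3(n)+ \frac{7}{240}n\sigma_5(n)$; (vi) $\sum^{n-1}_{m=1}m\sigma(m)\sigma_5(n-m) = \frac{1}{504}n\sigma(n) - \frac{1}{84}n^2\sigma_5(n) + \frac{5}{504}n\sigma_7(n)$; (vii) $\sum^{n-1}_{m=1}\sigma(m)\sigma_5(n-m) = \frac{1}{504}\sigma(n)-\frac{1}{12}n\sigma_5(n) + \frac{1}{24} \sigma_5(n) + \frac{5}{126}\sigma_7(n)$; (viii) $\sum^{n-1}_{m=1}\sigma(m)\sigma_7(n-m) = -\frac{1}{480}\sigma(n)+\frac{1}{24} \sigma_7(n)+\frac{11}{480}\sigma_9(n)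 - \frac{1}{16}n\sigma_7(n)$.
   Context: For $k\ge 1$, $\sigma_k(n)=\sum_{d\mid n} d^k$ (sum over positive divisors of $n$), and $\sigma(n)=\sigma_1(n)$. For $n=1$ the sum $\sum_{m=1}^{n-1}$ is empty and equals $0$. *)

(* Defs.v *)
From mathcomp Require Import all_boot all_order all_algebra.

Set Implicit Arguments.
Unset Strict Implicit.
Unset Printing Implicit Defensive.

Definition sigma (k n : nat) : nat := \sum_(d <- divisors n) d ^ k.

(* Main.v *)
Require Import Defs.
From HB Require Import structures.
From mathcomp Require Import all_boot all_order all_algebra.
From mathcomp Require Import zify ring lra.

(* The sums without the weight [m ^ j] are evaluated by Skoruppa's argument. On
   the positive solutions of [a x + b y = n], the Euclidean step
   [(a, b, x, y) |-> (a, a + b, x - y, y)] maps [x > y] bijectively to [a < b].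
   For an even polynomial [h] in [a], [b] which is symmetric in
   [a], [b], [- (a + b)], this makes the sum of [h a b - h a (- b)] collapse to
   the diagonals [x = y] and [a = b], where it is a combination of power sums
   over the divisors of [n]. Taking [h] to be a product of powers of
   [a ^ 2 + a b + b ^ 2] and [(a b (a + b)) ^ 2] produces the convolutions of
   [sigma 1] with [sigma 1], [sigma 3], [sigma 5], [sigma 7], and of [sigma 3]
   with itself.
   In terms of generating series, these are Ramanujan's differential equations
   for [E2], [E4], [E6]; the weighted sums are coefficients of products such as
   [(theta E2) E4], where [theta = X d/dX], and the equations express these
   products as linear combinations of derivatives of [E2], [E4], [E6] and
   [E4 ^ 2]. *)

Import GRing.Theory Num.Theory.
Local Open Scope ring_scope.

(** * Positive solutions of [a x + b y = n] and their link with convolutions *)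

Definition factorizations (m : nat) : seq (nat * nat) :=
  [seq (d, (m %/ d)%N) | d <- divisors m].

Lemma mem_factorizations m d e : (0 < m)%N ->
  ((d, e) \in factorizations m) = [&& (0 < d)%N, (0 < e)%N & (d * e == m)%N].
Proof.
move=> m0; apply/mapP/and3P => [[f]|[d0 e0 /eqP <-]].
  rewrite -dvdn_divisors // => /dvdnP[q mE] [-> ->].
  have f0 : (0 < f)%N by move: m0; rewrite mE muln_gt0 => /andP[].
  rewrite f0 mE mulnK // mulnC eqxx; split=> //.
  by move: m0; rewrite mE muln_gt0 => /andP[].
exists d; last by rewrite mulKn.
by rewrite -dvdn_divisors ?muln_gt0 ?d0 // dvdn_mulr.
Qed.

Lemma factorizations_uniq m : uniq (factorizations m).
Proof. by rewrite map_inj_uniq ?divisors_uniq // => a b []. Qed.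

(* The entry [((a, x), (b, y))] stands for the solution [a x + b y = n]. *)
Definition quads (n : nat) : seq ((nat * nat) * (nat * nat)) :=
  [seq z | m <- index_iota 1 n,
           z <- [seq (p, q) | p <- factorizations m,
                              q <- factorizations (n - m)]].

Lemma mem_quads n a x b y :
  (((a, x), (b, y)) \in quads n) =
  [&& (0 < a)%N, (0 < x)%N, (0 < b)%N, (0 < y)%N & (a * x + b * y == n)%N].
Proof.
apply/allpairsPdep/and5P => [[m [z [+ /allpairsP[[p q] [/= mp mq ->]] [pE qE]]]]|].
  rewrite mem_index_iota => /andP[m0 mn].
  move: mp mq; rewrite -pE -qE !mem_factorizations ?subn_gt0 //.
  move=> /and3P[a0 x0 /eqP ->] /and3P[b0 y0 /eqP ->].
  by rewrite subnKC // ltnW.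
move=> [a0 x0 b0 y0 /eqP <-]; exists (a * x)%N, ((a, x), (b, y)); split=> //.
  rewrite mem_index_iota muln_gt0 a0 x0.
  by rewrite -[X in (X < _)%N]addn0 ltn_add2l muln_gt0 b0.
apply/allpairsP; exists ((a, x), (b, y)).
by rewrite addKn !mem_factorizations ?muln_gt0 ?a0 ?x0 ?b0 ?y0 ?eqxx.
Qed.

Lemma quads_uniq n : uniq (quads n).
Proof.
apply: allpairs_uniq_dep => [|m _|]; first exact: iota_uniq.
  apply: allpairs_uniq; [exact: factorizations_uniq..|].
  by move=> [p q] [p' q'].
move=> _ _ /allpairsPdep[m [z [m0 mz ->]]] /allpairsPdep[m' [z' [m0' mz' ->]]] /= zE.
move: m0 m0'; rewrite !mem_index_iota => /andP[m0 _] /andP[m0' _].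
move: mz mz'; rewrite -{z'}zE.
move=> /allpairsP[[[a x] q] [/= mp _ ->]] /allpairsP[[p' q'] [/= + _ [pE qE]]].
move: mp; rewrite -pE !mem_factorizations //.
by move=> /and3P[_ _ /eqP <-] /and3P[_ _ /eqP <-].
Qed.

Lemma sum_quads (V : nmodType) n (F : nat -> nat -> V) :
  \sum_(z <- quads n) F z.1.1 z.2.1 =
  \sum_(1 <= m < n) \sum_(a <- divisors m) \sum_(b <- divisors (n - m)) F a b.
Proof.
rewrite big_allpairs_dep; apply: eq_bigr => m _.
rewrite big_allpairs_dep big_map; apply: eq_bigr => a _.
by rewrite big_map.
Qed.

Lemma sum_quads_sigma n k l :
  \sum_(z <- quads n) z.1.1%:R ^+ k * z.2.1%:R ^+ l =
  \sum_(1 <= m < n) (sigma k m)%:R * (sigma l (n - m))%:R :> rat.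
Proof.
rewrite (sum_quads _ n (fun a b => a%:R ^+ k * b%:R ^+ l : rat)).
apply: eq_bigr => m _; rewrite /sigma !natr_sum mulr_suml.
apply: eq_bigr => a _; rewrite mulr_sumr; apply: eq_bigr => b _.
by rewrite !natrX.
Qed.

(** * Symmetries of the solution set, the Euclidean step and the diagonals *)

Definition swap_quad (z : (nat * nat) * (nat * nat)) := (z.2, z.1).
Definition flip_quad (z : (nat * nat) * (nat * nat)) :=
  ((z.1.2, z.1.1), (z.2.2, z.2.1)).

Lemma perm_swap_quads n : perm_eq [seq swap_quad z | z <- quads n] (quads n).
Proof.
have K : involutive swap_quad by case.
apply: uniq_perm; rewrite ?map_inj_uniq ?quads_uniq //; first exact: inv_inj.
move=> [[a x] [b y]].
rewrite -[X in X \in map _ _](K ((a, x), (b, y))) mem_map; last exact: inv_inj.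
rewrite /swap_quad /= !mem_quads.
by apply/and5P/and5P; move=> [? ? ? ? /eqP E]; split=> //; lia.
Qed.

Lemma perm_flip_quads n : perm_eq [seq flip_quad z | z <- quads n] (quads n).
Proof.
have K : involutive flip_quad by move=> [[? ?] [? ?]].
apply: uniq_perm; rewrite ?map_inj_uniq ?quads_uniq //; first exact: inv_inj.
move=> [[a x] [b y]].
rewrite -[X in X \in map _ _](K ((a, x), (b, y))) mem_map; last exact: inv_inj.
rewrite /flip_quad /= !mem_quads.
by apply/and5P/and5P; move=> [? ? ? ? /eqP E]; split=> //; lia.
Qed.

(* One step of the Euclidean algorithm: [a x + b y = a (x - y) + (a + b) y]. *)
Lemma perm_euclid_quads n :
  perm_eq [seq ((z.1.1, (z.1.2 - z.2.2)%N), ((z.1.1 + z.2.1)%N, z.2.2))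
          | z <- quads n & (z.2.2 < z.1.2)%N]
          [seq z <- quads n | (z.1.1 < z.2.1)%N].
Proof.
apply: uniq_perm; [|by rewrite filter_uniq ?quads_uniq|].
  rewrite map_inj_in_uniq ?filter_uniq ?quads_uniq //.
  move=> [[a x] [b y]] [[a' x'] [b' y']]; rewrite !mem_filter /=.
  move=> /andP[xy _] /andP[xy' _] [-> E1 E2 E3]; congr (_, _, (_, _)); lia.
move=> [[a x] [b y]]; rewrite mem_filter /= mem_quads.
apply/mapP/andP => [[[[a' x'] [b' y']]]|[ab /and5P[a0 x0 b0 y0 /eqP E]]].
  rewrite mem_filter mem_quads /= => /andP[xy /and5P[a0 x0 b0 y0 /eqP E]].
  move=> [-> -> -> ->]; split; first lia.
  by apply/and5P; split; nia.
(* The inverse step, defined because [a < b]. *)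
exists ((a, (x + y)%N), ((b - a)%N, y)); last by congr (_, _, (_, _)) => /=; lia.
by rewrite mem_filter mem_quads /=; apply/andP; split; [lia|apply/and5P; split; nia].
Qed.

Lemma sum_quads_swap (V : nmodType) n (P : pred _) (F : _ -> V) :
  \sum_(z <- quads n | P z) F z =
  \sum_(z <- quads n | P (swap_quad z)) F (swap_quad z).
Proof. by rewrite -(perm_big _ (perm_swap_quads n)) big_map. Qed.

Lemma sum_quads_flip (V : nmodType) n (P : pred _) (F : _ -> V) :
  \sum_(z <- quads n | P z) F z =
  \sum_(z <- quads n | P (flip_quad z)) F (flip_quad z).
Proof. by rewrite -(perm_big _ (perm_flip_quads n)) big_map. Qed.

Lemma sum_quads_trichotomy (V : nmodType) n (u v : _ -> nat) (F : _ -> V) :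
  \sum_(z <- quads n) F z = \sum_(z <- quads n | (u z < v z)%N) F z +
   (\sum_(z <- quads n | (v z < u z)%N) F z + \sum_(z <- quads n | u z == v z) F z).
Proof.
rewrite (bigID (fun z => u z < v z)%N) /=; congr (_ + _).
rewrite (bigID (fun z => v z < u z)%N) /=; congr (_ + _);
  by apply: eq_bigl => z /=; case: (ltngtP (u z) (v z)).
Qed.

(** When [x = y] the equation reads [(a + b) x = n], so [e = a + b] is a divisor of [n], [x] is the
    codivisor, and [a] ranges freely below [e]. *)
Lemma sum_quads_diag (V : nmodType) n (F : nat -> nat -> nat -> V) : (0 < n)%N ->
  \sum_(z <- quads n | z.1.2 == z.2.2) F z.1.1 z.2.1 z.1.2 =
  \sum_(e <- divisors n) \sum_(1 <= a < e) F a (e - a)%N (n %/ e)%N.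
Proof.
move=> n0; rewrite -big_filter.
rewrite (perm_big [seq ((a, (n %/ e)%N), ((e - a)%N, (n %/ e)%N))
   | e <- divisors n, a <- index_iota 1 e]); first by rewrite big_allpairs_dep.
apply: uniq_perm; first by rewrite filter_uniq ?quads_uniq.
  apply: allpairs_uniq_dep => [|? _|]; [exact: divisors_uniq|exact: iota_uniq|].
  move=> _ _ /allpairsPdep[e [a [_ + ->]]] /allpairsPdep[e' [a' [_ + ->]]] /=.
  rewrite !mem_index_iota => he he' [aE _ E _]; rewrite -aE.
  by have -> : e = e' by lia.
move=> [[a x] [b y]]; rewrite mem_filter mem_quads /=.
apply/andP/allpairsPdep => [[/eqP <- /and5P[a0 x0 b0 _ /eqP E]]|[e [c [en]]]].
  exists (a + b)%N, a.
  have En : n = ((a + b) * x)%N by lia.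
  rewrite -dvdn_divisors // En dvdn_mulr // mem_index_iota mulKn ?addn_gt0 ?a0 //.
  by split=> //; [lia | congr (_, _, (_, _)); lia].
rewrite mem_index_iota => ce [-> -> -> ->]; rewrite eqxx; split=> //.
move: en; rewrite -dvdn_divisors // => en.
rewrite -mulnDl subnKC; last by lia.
have e0 := dvdn_gt0 n0 en.
have q0 : (0 < n %/ e)%N by rewrite divn_gt0 // dvdn_leq.
have E : (e * (n %/ e))%N = n by rewrite mulnC divnK.
by rewrite E eqxx q0 subn_gt0; case/andP: ce => -> ->.
Qed.

(* If [h] is an even symmetric polynomial in [a], [b], [- (a + b)], then both
   [h(a, b)] and [h(a, b - a) = h(a, -b)] are symmetric in [a] and [b]; hence
   everything off the diagonals cancels in the Euclidean step. *)
Lemma sum_quads_odd_part n (h : rat -> rat -> rat) : (0 < n)%N ->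
  (forall a b, h a b = h b a) -> (forall a b, h a (- b) = h b (- a)) ->
  (forall a b, h a (b - a) = h a (- b)) ->
  \sum_(z <- quads n) (h z.1.1%:R z.2.1%:R - h z.1.1%:R (- z.2.1%:R)) =
  \sum_(e <- divisors n) (\sum_(1 <= a < e) h a%:R (e%:R - a%:R) -
                          ((n%:R / e%:R) - 1) * h e%:R 0).
Proof.
move=> n0 hC hNC hE; rewrite big_split sumrN /=.
rewrite (sum_quads_trichotomy _ n (fun z => z.2.2) (fun z => z.1.2)).
rewrite [X in _ - X](sum_quads_trichotomy _ n (fun z => z.1.1) (fun z => z.2.1)).
have -> : \sum_(z <- quads n | (z.1.2 < z.2.2)%N) h z.1.1%:R z.2.1%:R =
          \sum_(z <- quads n | (z.2.2 < z.1.2)%N) h z.1.1%:R z.2.1%:R.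
  by rewrite sum_quads_swap; apply: eq_bigr => z _; rewrite hC.
have -> : \sum_(z <- quads n | (z.2.1 < z.1.1)%N) h z.1.1%:R (- z.2.1%:R) =
          \sum_(z <- quads n | (z.1.1 < z.2.1)%N) h z.1.1%:R (- z.2.1%:R).
  by rewrite sum_quads_swap; apply: eq_bigr => z _; rewrite hNC.
(* Transport along the Euclidean step, where [hE] at [a + b] gives [h a (- (a + b)) = h a b]. *)
have -> : \sum_(z <- quads n | (z.1.1 < z.2.1)%N) h z.1.1%:R (- z.2.1%:R) =
          \sum_(z <- quads n | (z.2.2 < z.1.2)%N) h z.1.1%:R z.2.1%:R.
  rewrite -big_filter -(perm_big _ (perm_euclid_quads n)) big_map big_filter.
  by apply: eq_bigr => z _ /=; rewrite -hE natrD addrAC subrr add0r.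
rewrite [X in _ - X]addrA [X in X - _]addrA.
(* The four off-diagonal sums are now equal and cancel; the diagonal [x = y] minus the diagonal
   [a = b] remains. *)
rewrite opprD addrACA subrr add0r sumrB; congr (_ - _).
  under eq_bigl do rewrite eq_sym.
  rewrite (sum_quads_diag _ n (fun a b _ => h a%:R b%:R)) //.
  apply: eq_bigr => e _; apply: eq_big_nat => a /andP[_ /ltnW ae].
  by rewrite natrB.
(* Exchanging coefficients and unknowns turns the diagonal [a = b] into [x = y]. The summand then
   depends on [n %/ e] only and occurs [e - 1] times; the involution [e |-> n %/ e] on divisors
   finishes. *)
rewrite sum_quads_flip /=.
under eq_bigr => z /eqP <- do [].
rewrite (sum_quads_diag _ n (fun _ _ x => h x%:R (- x%:R))) //=.
transitivity (\sum_(e <- divisors n) (e%:R - 1) * h (n %/ e)%N%:R (- (n %/ e)%N%:R)).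
  rewrite !big_seq; apply: eq_bigr => e; rewrite -dvdn_divisors // => en.
  rewrite sumr_const_nat -[LHS]mulr_natl natrB //; exact: dvdn_gt0 en.
have dK e : e \in divisors n -> (n %/ (n %/ e))%N = e.
  rewrite -dvdn_divisors // => en; have e0 := dvdn_gt0 n0 en.
  by rewrite -{1}(divnK en) mulKn // divn_gt0 // dvdn_leq.
have pd : perm_eq [seq (n %/ e)%N | e <- divisors n] (divisors n).
  apply: uniq_perm; rewrite ?map_inj_in_uniq ?divisors_uniq //.
    by move=> e f /dK {2}<- /dK {2}<- ->.
  move=> e; apply/mapP/idP => [[f fn ->]|en].
    by rewrite -dvdn_divisors // dvdn_div // dvdn_divisors.
  exists (n %/ e)%N; last by rewrite dK.
  by rewrite -dvdn_divisors // dvdn_div // dvdn_divisors.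
rewrite -(perm_big _ pd) big_map !big_seq; apply: eq_bigr => e en.
rewrite dK // -hE subrr; congr ((_ - _) * _).
move: en; rewrite -dvdn_divisors // => en; have e0 := dvdn_gt0 n0 en.
rewrite -[in RHS](divnK en) natrM mulfK //.
by rewrite pnatr_eq0 -lt0n.
Qed.

(* The sum of [a ^ k] over [1 <= a < x]; a junk value [0] for [k > 8]. *)
Definition faulhaber (k : nat) (x : rat) : rat :=
  match k with
  | 0%N => x - 1
  | 1%N => x ^+ 2 / 2 - x / 2
  | 2%N => x ^+ 3 / 3 - x ^+ 2 / 2 + x / 6
  | 3%N => x ^+ 4 / 4 - x ^+ 3 / 2 + x ^+ 2 / 4
  | 4%N => x ^+ 5 / 5 - x ^+ 4 / 2 + x ^+ 3 / 3 - x / 30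
  | 5%N => x ^+ 6 / 6 - x ^+ 5 / 2 + 5 / 12 * x ^+ 4 - x ^+ 2 / 12
  | 6%N => x ^+ 7 / 7 - x ^+ 6 / 2 + x ^+ 5 / 2 - x ^+ 3 / 6 + x / 42
  | 7%N => x ^+ 8 / 8 - x ^+ 7 / 2 + 7 / 12 * x ^+ 6 - 7 / 24 * x ^+ 4
           + x ^+ 2 / 12
  | 8%N => x ^+ 9 / 9 - x ^+ 8 / 2 + 2 / 3 * x ^+ 7 - 7 / 15 * x ^+ 5
           + 2 / 9 * x ^+ 3 - x / 30
  | _ => 0
  end.

Lemma faulhaber1 k : faulhaber k 1 = 0.
Proof. by do 9?[case: k => [|k]; first by rewrite /faulhaber; field]. Qed.

Lemma faulhaberS k x : (k <= 8)%N ->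
  faulhaber k (x + 1) = faulhaber k x + x ^+ k.
Proof.
by do 9?[case: k => [|k]; first by move=> _; rewrite /faulhaber; field].
Qed.

(** * Closed forms of the unweighted convolutions *)

Definition sigma_conv (k l n : nat) : rat :=
  \sum_(1 <= m < n) (sigma k m)%:R * (sigma l (n - m))%:R.

Lemma sigma_convC k l n : sigma_conv k l n = sigma_conv l k n.
Proof.
rewrite /sigma_conv -!sum_quads_sigma sum_quads_swap /=.
by apply: eq_bigr => z _; rewrite mulrC.
Qed.

Lemma natr_sigma k n :
  (sigma k n)%:R = \sum_(e <- divisors n) e%:R ^+ k :> rat.
Proof. by rewrite natr_sum; apply: eq_bigr => e _; rewrite natrX. Qed.

(* [g y] is an antidifference of [a |-> h a (y - a)]; [w] lists the monomials of
   twice the part of [h] that is odd in [b]. *)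
Lemma sigma_conv_identity n (h g : rat -> rat -> rat)
    (w : seq (rat * (nat * nat))) (v : seq (rat * nat)) : (0 < n)%N ->
  (forall a b, h a b = h b a) -> (forall a b, h a (- b) = h b (- a)) ->
  (forall a b, h a (b - a) = h a (- b)) ->
  (forall y, g y 1 = 0) -> (forall y x, g y (x + 1) = g y x + h x (y - x)) ->
  (forall a b,
    \sum_(t <- w) t.1 * (a ^+ t.2.1 * b ^+ t.2.2) = h a b - h a (- b)) ->
  (forall e, e != 0 ->
    \sum_(t <- v) t.1 * e ^+ t.2 = g e e - (n%:R / e - 1) * h e 0) ->
  \sum_(t <- w) t.1 * sigma_conv t.2.1 t.2.2 n =
  \sum_(t <- v) t.1 * (sigma t.2 n)%:R.
Proof.
move=> n0 hC hNC hE g1 gS wE vE.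
transitivity (\sum_(z <- quads n) (h z.1.1%:R z.2.1%:R - h z.1.1%:R (- z.2.1%:R))).
  under [RHS]eq_bigr do rewrite -wE.
  rewrite exchange_big; apply: eq_bigr => t _.
  by rewrite -mulr_sumr sum_quads_sigma.
under [RHS]eq_bigr do rewrite natr_sigma mulr_sumr.
rewrite exchange_big sum_quads_odd_part // !big_seq.
apply: eq_bigr => e; rewrite -dvdn_divisors // => en.
have e0 := dvdn_gt0 n0 en.
rewrite vE ?pnatr_eq0 -?lt0n //; congr (_ - _).
(* The sum telescopes to [g e e - g e 1], and [g e 1 = 0]. *)
rewrite (@telescope_sumr_eq _ 1 e (fun a => g e%:R a%:R)) ?g1 ?subr0 //.
by move=> a _; rewrite -addn1 natrD gS addrAC subrr add0r.
Qed.

Ltac prove_sigma_conv n h g w v :=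
  have : \sum_(t <- w) t.1 * sigma_conv t.2.1 t.2.2 n =
         \sum_(t <- v) t.1 * (sigma t.2 n)%:R;
  [ apply: (sigma_conv_identity n h g);
    [ assumption | by move=> a b; ring | by move=> a b; ring
    | by move=> a b; ring
    | by move=> y; rewrite !faulhaber1; ring
    | by move=> y x; rewrite !faulhaberS; [ring | exact: isT ..]
    | by move=> a b; rewrite !big_cons !big_nil /=; ring
    | by move=> e e0; rewrite !big_cons !big_nil /faulhaber /=; field ]
  | rewrite !big_cons !big_nil /= ].

(** On [a + b = y] the quadratic form becomes [y ^ 2 - y a + a ^ 2]; replacing powers of [a] by
    power sums gives the antidifference. The later evaluations expand their [h] in the same way. *)
Lemma sigma_conv11 n : (0 < n)%N ->
  sigma_conv 1 1 n =
  5 / 12 * (sigma 3 n)%:R + 1 / 12 * (sigma 1 n)%:R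
  - 1 / 2 * n%:R * (sigma 1 n)%:R.
Proof.
move=> n0; prove_sigma_conv n
  (fun a b : rat => a ^+ 2 + a * b + b ^+ 2)
  (fun y x => y ^+ 2 * faulhaber 0 x - y * faulhaber 1 x + faulhaber 2 x)
  ([:: (2, (1, 1))] : seq (rat * (nat * nat)))
  ([:: (5 / 6, 3); (1 / 6, 1); (- n%:R, 1)] : seq (rat * nat)).
lra.
Qed.

Lemma sigma_conv13 n : (0 < n)%N ->
  sigma_conv 1 3 n =
  7 / 80 * (sigma 5 n)%:R + 1 / 24 * (sigma 3 n)%:R
  - 1 / 240 * (sigma 1 n)%:R - 1 / 8 * n%:R * (sigma 3 n)%:R.
Proof.
move=> n0; prove_sigma_conv n
  (fun a b : rat => (a ^+ 2 + a * b + b ^+ 2) ^+ 2)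
  (fun y x => y ^+ 4 * faulhaber 0 x - 2 * y ^+ 3 * faulhaber 1 x
     + 3 * y ^+ 2 * faulhaber 2 x - 2 * y * faulhaber 3 x
     + faulhaber 4 x)
  ([:: (4, (1, 3)); (4, (3, 1))] : seq (rat * (nat * nat)))
  ([:: (7 / 10, 5); (1 / 3, 3); (- 1 / 30, 1); (- n%:R, 3)]
     : seq (rat * nat)).
rewrite (sigma_convC 3 1); lra.
Qed.

(** This [h] vanishes at [b = 0], so no term with a factor [n] appears, and [a ^ 3 b ^ 3] is its
    only monomial of odd degree in [b]. *)
Lemma sigma_conv33 n : (0 < n)%N ->
  sigma_conv 3 3 n =
  1 / 120 * (sigma 7 n)%:R - 1 / 120 * (sigma 3 n)%:R.
Proof.
move=> n0; prove_sigma_conv n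
  (fun a b : rat => (a * b * (a + b)) ^+ 2)
  (fun y x => y ^+ 4 * faulhaber 2 x - 2 * y ^+ 3 * faulhaber 3 x
     + y ^+ 2 * faulhaber 4 x)
  ([:: (4, (3, 3))] : seq (rat * (nat * nat)))
  ([:: (1 / 30, 7); (- 1 / 30, 3)] : seq (rat * nat)).
lra.
Qed.

(** The cube of the quadratic form also contains [7 a ^ 3 b ^ 3], which [sigma_conv33] removes. *)
Lemma sigma_conv15 n : (0 < n)%N ->
  sigma_conv 1 5 n =
  1 / 504 * (sigma 1 n)%:R - 1 / 12 * n%:R * (sigma 5 n)%:R
  + 1 / 24 * (sigma 5 n)%:R + 5 / 126 * (sigma 7 n)%:R.
Proof.
move=> n0; have h33 := sigma_conv33 n n0; prove_sigma_conv n
  (fun a b : rat => (a ^+ 2 + a * b + b ^+ 2) ^+ 3)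
  (fun y x => y ^+ 6 * faulhaber 0 x - 3 * y ^+ 5 * faulhaber 1 x
     + 6 * y ^+ 4 * faulhaber 2 x - 7 * y ^+ 3 * faulhaber 3 x
     + 6 * y ^+ 2 * faulhaber 4 x - 3 * y * faulhaber 5 x
     + faulhaber 6 x)
  ([:: (6, (1, 5)); (6, (5, 1)); (14, (3, 3))] : seq (rat * (nat * nat)))
  ([:: (83 / 140, 7); (1 / 2, 5); (- 7 / 60, 3); (1 / 42, 1); (- n%:R, 5)]
     : seq (rat * nat)).
rewrite (sigma_convC 5 1); lra.
Qed.

Lemma sigma_conv35 n : (0 < n)%N ->
  sigma_conv 3 5 n =
  11 / 5040 * (sigma 9 n)%:R - 1 / 240 * (sigma 5 n)%:R
  + 1 / 504 * (sigma 3 n)%:R.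
Proof.
move=> n0; prove_sigma_conv n
  (fun a b : rat => (a * b * (a + b)) ^+ 2 * (a ^+ 2 + a * b + b ^+ 2))
  (fun y x => y ^+ 6 * faulhaber 2 x - 3 * y ^+ 5 * faulhaber 3 x
     + 4 * y ^+ 4 * faulhaber 4 x - 3 * y ^+ 3 * faulhaber 5 x
     + y ^+ 2 * faulhaber 6 x)
  ([:: (6, (3, 5)); (6, (5, 3))] : seq (rat * (nat * nat)))
  ([:: (11 / 420, 9); (- 1 / 20, 5); (1 / 42, 3)] : seq (rat * nat)).
rewrite (sigma_convC 5 3); lra.
Qed.

(** The fourth power also contains [a ^ 3 b ^ 5] and [a ^ 5 b ^ 3], each with coefficient 16;
    [sigma_conv35] removes them. *)
Lemma sigma_conv17 n : (0 < n)%N ->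
  sigma_conv 1 7 n =
  - (1 / 480 * (sigma 1 n)%:R) + 1 / 24 * (sigma 7 n)%:R
  + 11 / 480 * (sigma 9 n)%:R - 1 / 16 * n%:R * (sigma 7 n)%:R.
Proof.
move=> n0; have h35 := sigma_conv35 n n0; prove_sigma_conv n
  (fun a b : rat => (a ^+ 2 + a * b + b ^+ 2) ^+ 4)
  (fun y x => y ^+ 8 * faulhaber 0 x - 4 * y ^+ 7 * faulhaber 1 x
     + 10 * y ^+ 6 * faulhaber 2 x - 16 * y ^+ 5 * faulhaber 3 x
     + 19 * y ^+ 4 * faulhaber 4 x - 16 * y ^+ 3 * faulhaber 5 x
     + 10 * y ^+ 2 * faulhaber 6 x - 4 * y * faulhaber 7 x
     + faulhaber 8 x)
  ([:: (8, (1, 7)); (8, (7, 1)); (32, (3, 5)); (32, (5, 3))]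
     : seq (rat * (nat * nat)))
  ([:: (319 / 630, 9); (2 / 3, 7); (- 4 / 15, 5); (8 / 63, 3); (- 1 / 30, 1); (- n%:R, 7)]
     : seq (rat * nat)).
rewrite (sigma_convC 7 1) (sigma_convC 5 3); lra.
Qed.

(** * Truncated power series and the derivation [theta] *)

(** Congruence to 0 modulo [X ^ (n + 1)]: an ideal stable under [theta], so relations can be
    multiplied, added and differentiated. *)
Definition zero_upto (n : nat) (p : {poly rat}) : Prop :=
  forall i, (i <= n)%N -> p`_i = 0.

HB.lock Definition theta (p : {poly rat}) : {poly rat} := 'X * p^`().

Lemma coef_theta p i : (theta p)`_i = i%:R * p`_i.
Proof.
by rewrite unlock coefXM coef_deriv mulr_natl; case: i => [|i] //=; rewrite mulr0n.
Qed.

Lemma thetaD p q : theta (p + q) = theta p + theta q.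
Proof. by rewrite !unlock derivD mulrDr. Qed.

Lemma thetaN p : theta (- p) = - theta p.
Proof. by rewrite !unlock derivN mulrN. Qed.

Lemma thetaM p q : theta (p * q) = theta p * q + p * theta q.
Proof. by rewrite !unlock derivM; ring. Qed.

Lemma theta_nat k : theta k%:R = 0.
Proof. by rewrite !unlock -polyC_natr derivC mulr0. Qed.

Lemma theta1 : theta 1 = 0.
Proof. exact: theta_nat 1. Qed.

Lemma theta0 : theta 0 = 0.
Proof. exact: theta_nat 0. Qed.

Definition thetaE := (thetaD, thetaN, thetaM, theta_nat, theta0, theta1).

Lemma zero_uptoD n p q : zero_upto n p -> zero_upto n q -> zero_upto n (p + q).
Proof. by move=> hp hq i ile; rewrite coefD hp ?hq ?addr0. Qed.

Lemma zero_uptoMl n p q : zero_upto n q -> zero_upto n (p * q).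
Proof.
move=> hq i ile; rewrite coefM big1 // => j _.
by rewrite hq ?mulr0 // (leq_trans (leq_subr _ _)).
Qed.

Lemma zero_upto_theta n p : zero_upto n p -> zero_upto n (theta p).
Proof. by move=> hp i ile; rewrite coef_theta hp ?mulr0. Qed.

Lemma zero_upto_natl n k p : (0 < k)%N ->
  zero_upto n (k%:R * p) -> zero_upto n p.
Proof.
move=> k0 h i ile; have /eqP := h i ile.
by rewrite mulr_natl coefMn mulrn_eq0 eqn0Ngt k0 => /eqP.
Qed.

(** * Consequences of Ramanujan's differential equations *)

Ltac close_zero_upto :=
  repeat first [ assumption | apply: zero_upto_theta | apply: zero_uptoD
               | apply: zero_uptoMl ].

(* [p], [q], [r] stand for the Eisenstein series [E2], [E4], [E6]; the hypotheses
   are Ramanujan's differential equations. *)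
Lemma theta_E2_E4 n p q r :
  zero_upto n (12 * theta p - p * p + q) ->
  zero_upto n (3 * theta q - p * q + r) ->
  zero_upto n (2 * theta r - p * r + q * q) ->
  zero_upto n (15 * (theta p * q) - 9 * theta (theta q) - 5 * theta r).
Proof.
set e1 := (X in zero_upto n X -> _ -> _).
set e2 := (X in _ -> zero_upto n X -> _ -> _).
set e3 := (X in _ -> _ -> zero_upto n X -> _).
move=> h1 h2 h3.
(* An explicit certificate: the target lies in the differential ideal generated by the three
   equations. *)
rewrite [X in zero_upto n X](_ : _ =
  q * e1 + ((- p) * e2 + ((- 3) * theta e2 + (-1) * e3))).
  by close_zero_upto.
rewrite /e1 /e2 /e3 !thetaE; ring.
Qed.

Lemma theta_E2_sq n p q r :
  zero_upto n (12 * theta p - p * p + q) ->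
  zero_upto n (3 * theta q - p * q + r) ->
  zero_upto n (2 * theta r - p * r + q * q) ->
  zero_upto n (5 * (theta p * theta p) - 10 * theta (theta (theta p))
               - theta (theta q)).
Proof.
move=> h1 h2 h3; have h4 := theta_E2_E4 n p q r h1 h2 h3.
move: h1 h2 h3 h4.
set e1 := (X in zero_upto n X -> _); set e2 := (X in _ -> zero_upto n X -> _).
set e3 := (X in _ -> _ -> zero_upto n X -> _).
set e4 := (X in _ -> _ -> _ -> zero_upto n X -> _).
(* The factor 36 clears the denominators of the certificate. *)
move=> h1 h2 h3 h4; apply: (zero_upto_natl n 36 _ isT).
rewrite [X in zero_upto n X](_ : _ =
  (- 30) * theta (theta e1) + (10 * theta p * e1 + ((- 5) * p * theta e1 +
  ((- 5) * theta e2 + (-1) * e4)))).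
  by close_zero_upto.
rewrite /e1 /e2 /e3 /e4 !thetaE; ring.
Qed.

Lemma theta_E2_E6 n p q r :
  zero_upto n (12 * theta p - p * p + q) ->
  zero_upto n (3 * theta q - p * q + r) ->
  zero_upto n (2 * theta r - p * r + q * q) ->
  zero_upto n (28 * (theta p * r) - 8 * theta (theta r) - 7 * theta (q * q)).
Proof.
set e1 := (X in zero_upto n X -> _ -> _).
set e2 := (X in _ -> zero_upto n X -> _ -> _).
set e3 := (X in _ -> _ -> zero_upto n X -> _).
move=> h1 h2 h3.
rewrite [X in zero_upto n X](_ : _ =
  2 * r * e1 + ((- 2) * q * e2 + ((- 4) * theta e3 + (- 2) * p * e3))).
  by close_zero_upto.
rewrite /e1 /e2 /e3 !thetaE; ring.
Qed.

(** All terms have weight 10, as in [theta_E2_E6], so both earlier relations can enter the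
    certificate: [theta_E2_E4] after multiplication by [p] or application of [theta]. *)
Lemma theta2_E2_E4 n p q r :
  zero_upto n (12 * theta p - p * p + q) ->
  zero_upto n (3 * theta q - p * q + r) ->
  zero_upto n (2 * theta r - p * r + q * q) ->
  zero_upto n (35 * (theta (theta p) * q) - 7 * theta (theta (theta q))
               - 5 * theta (theta r)).
Proof.
move=> h1 h2 h3; have h4 := theta_E2_E4 n p q r h1 h2 h3.
have h5 := theta_E2_E6 n p q r h1 h2 h3.
move: h1 h2 h3 h4 h5.
set e1 := (X in zero_upto n X -> _); set e2 := (X in _ -> zero_upto n X -> _).
set e3 := (X in _ -> _ -> zero_upto n X -> _).
set e4 := (X in _ -> _ -> _ -> zero_upto n X -> _).
set e5 := (X in _ -> _ -> _ -> _ -> zero_upto n X -> _).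
move=> h1 h2 h3 h4 h5; apply: (zero_upto_natl n 324 _ isT).
rewrite [X in zero_upto n X](_ : _ =
  140 * p * e4 + ((- 1260) * theta (theta e2) + ((- 700) * theta e3 +
  (1050 * q * theta e1 + ((- 168) * theta e4 + (- 25) * e5))))).
  by close_zero_upto.
rewrite /e1 /e2 /e3 /e4 /e5 !thetaE; ring.
Qed.

(* The constant term is dropped: [sigma k 0] would be [1], as [divisors 0] is
   [[:: 1]]. *)
Definition gen (n : nat) (a : nat -> rat) : {poly rat} :=
  \poly_(i < n.+1) (if i == 0%N then 0 else a i).

Lemma coef_gen n a i : (0 < i <= n)%N -> (gen n a)`_i = a i.
Proof. by case: i => // i /= ile; rewrite coef_poly ltnS ile. Qed.

Lemma coef0_gen n a : (gen n a)`_0 = 0.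
Proof. by rewrite coef_poly. Qed.

Lemma theta_gen n a : theta (gen n a) = gen n (fun i => i%:R * a i).
Proof.
apply/polyP => -[|i]; rewrite coef_theta !coef_poly /= ?mul0r //.
by case: ifP; rewrite ?mulr0.
Qed.

Lemma coef_genM n a b i : (i <= n)%N ->
  (gen n a * gen n b)`_i = \sum_(1 <= m < i) a m * b (i - m)%N.
Proof.
move=> ile; rewrite coefM.
rewrite -(big_mkord xpredT (fun j => (gen n a)`_j * (gen n b)`_(i - j))).
(* Both end terms of the Cauchy product contain a constant coefficient, which is 0. *)
rewrite big_nat_recl // coef0_gen mul0r add0r.
case: i ile => [|i] ile; first by rewrite !big_geq.
rewrite big_nat_recr //= subnn coef0_gen mulr0 addr0 big_add1 /=.
apply: eq_big_nat => j /andP[_ ji].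
by rewrite !coef_gen //; lia.
Qed.

(** * Truncated Eisenstein series and the proof of Ramanujan's equations *)

Definition sigma_gen (n k : nat) := gen n (fun i => (sigma k i)%:R).

Lemma coef_sigma_genM n k l i : (i <= n)%N ->
  (sigma_gen n k * sigma_gen n l)`_i = sigma_conv k l i.
Proof. exact: coef_genM. Qed.

Lemma coef_natlM k (p : {poly rat}) i : (k%:R * p)`_i = k%:R * p`_i.
Proof. by rewrite !mulr_natl coefMn. Qed.

Lemma zero_upto_eq n p p' : zero_upto n p -> p = p' -> p'`_n = 0.
Proof. by move=> h <-; exact: h. Qed.

(* All identities between these truncated Eisenstein series hold only up to
   degree [n]. *)
Definition E2 n := 1 - 24 * sigma_gen n 1.
Definition E4 n := 1 + 240 * sigma_gen n 3.
Definition E6 n := 1 - 504 * sigma_gen n 5.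

Lemma sigma_conv0 k l : sigma_conv k l 0 = 0.
Proof. by rewrite /sigma_conv big_geq. Qed.

Ltac zero_upto_by_coef :=
  let i := fresh "i" in let ile := fresh "ile" in let i0 := fresh "i0" in
  move=> i ile; rewrite !(coefD, coefN, coef_natlM, coef_theta);
  (* Degree 0 is separate, since the closed forms of the convolutions require a positive index. *)
  rewrite !(coef_sigma_genM _ _ _ _ ile); have [i0|i0] := posnP i;
  [ rewrite i0 !coef0_gen !sigma_conv0; ring
  | rewrite ?(sigma_conv11 i i0) ?(sigma_conv13 i i0) ?(sigma_conv15 i i0);
    rewrite ?(sigma_conv33 i i0) !(coef_gen _ _ i _); [field | by rewrite i0 ile ..] ].

Lemma theta_E2 n : zero_upto n (12 * theta (E2 n) - E2 n * E2 n + E4 n).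
Proof.
rewrite [X in zero_upto n X](_ : _ =
  - (576 * (sigma_gen n 1 * sigma_gen n 1)) + 240 * sigma_gen n 3
  + 48 * sigma_gen n 1 - 288 * theta (sigma_gen n 1)).
  by zero_upto_by_coef.
rewrite /E2 /E4 !thetaE; ring.
Qed.

Lemma theta_E4 n : zero_upto n (3 * theta (E4 n) - E2 n * E4 n + E6 n).
Proof.
rewrite [X in zero_upto n X](_ : _ =
  24 * (240 * (sigma_gen n 1 * sigma_gen n 3)) - 504 * sigma_gen n 5
  - 240 * sigma_gen n 3 + 24 * sigma_gen n 1 + 720 * theta (sigma_gen n 3)).
  by zero_upto_by_coef.
rewrite /E2 /E4 /E6 !thetaE; ring.
Qed.

(** Coefficientwise this combines [sigma_conv33], from the square of [E4], with [sigma_conv15], from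
    [E2 E6]. *)
Lemma theta_E6 n : zero_upto n (2 * theta (E6 n) - E2 n * E6 n + E4 n * E4 n).
Proof.
rewrite [X in zero_upto n X](_ : _ =
  240 * (240 * (sigma_gen n 3 * sigma_gen n 3))
  - 24 * (504 * (sigma_gen n 1 * sigma_gen n 5)) + 504 * sigma_gen n 5
  + 480 * sigma_gen n 3 + 24 * sigma_gen n 1 - 1008 * theta (sigma_gen n 5)).
  by zero_upto_by_coef.
rewrite /E2 /E4 /E6 !thetaE; ring.
Qed.

(** * Weighted convolutions as coefficients of the derived relations *)

Lemma sum_id_sigma13 n : (0 < n)%N ->
  240 * (\sum_(1 <= m < n) m%:R * (sigma 1 m)%:R * (sigma 3 (n - m))%:R) =
  7 * n%:R * (sigma 5 n)%:R - 6 * n%:R ^+ 2 * (sigma 3 n)%:R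
  - n%:R * (sigma 1 n)%:R :> rat.
Proof.
move=> n0.
(* Constant terms of the Eisenstein series are expanded away: [360 = 15 * 24], [2160 = 9 * 240],
   [2520 = 5 * 504]. The factor [m] comes from [theta] acting on the series of [sigma 1]. *)
have : (- (360 * theta (sigma_gen n 1))
  - 360 * (240 * (theta (sigma_gen n 1) * sigma_gen n 3))
  - 2160 * theta (theta (sigma_gen n 3)) + 2520 * theta (sigma_gen n 5))`_n = 0.
  apply: (zero_upto_eq _ _ _ (theta_E2_E4 n _ _ _ (theta_E2 n)
    (theta_E4 n) (theta_E6 n))).
  rewrite /E2 /E4 /E6 !thetaE; ring.
rewrite !theta_gen !(coefD, coefN, coef_natlM).
rewrite (coef_genM _ _ _ _ (leqnn n)) !(coef_gen _ _ n);
  [|by rewrite n0 leqnn ..].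
lra.
Qed.

Lemma sum_sqr_sigma13 n : (0 < n)%N ->
  240 * (\sum_(1 <= m < n) m%:R ^+ 2 * (sigma 1 m)%:R * (sigma 3 (n - m))%:R) =
  3 * n%:R ^+ 2 * (sigma 5 n)%:R - 2 * n%:R ^+ 3 * (sigma 3 n)%:R
  - n%:R ^+ 2 * (sigma 1 n)%:R :> rat.
Proof.
move=> n0.
have : (- (840 * theta (theta (sigma_gen n 1)))
  - 840 * (240 * (theta (theta (sigma_gen n 1)) * sigma_gen n 3))
  - 1680 * theta (theta (theta (sigma_gen n 3)))
  + 2520 * theta (theta (sigma_gen n 5)))`_n = 0.
  apply: (zero_upto_eq _ _ _ (theta2_E2_E4 n _ _ _ (theta_E2 n)
    (theta_E4 n) (theta_E6 n))).
  rewrite /E2 /E4 /E6 !thetaE; ring.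
rewrite !theta_gen !(coefD, coefN, coef_natlM).
rewrite (coef_genM _ _ _ _ (leqnn n)) !(coef_gen _ _ n);
  [|by rewrite n0 leqnn ..].
under eq_bigr do rewrite mulrA -expr2.
lra.
Qed.

Lemma sum_id_sigma15 n : (0 < n)%N ->
  504 * (\sum_(1 <= m < n) m%:R * (sigma 1 m)%:R * (sigma 5 (n - m))%:R) =
  n%:R * (sigma 1 n)%:R - 6 * n%:R ^+ 2 * (sigma 5 n)%:R
  + 5 * n%:R * (sigma 7 n)%:R :> rat.
Proof.
move=> n0.
(* Here [theta (E4 ^ 2)] leaves the square of the [sigma 3] series, evaluated by [sigma_conv33]. *)
have : (- (672 * theta (sigma_gen n 1))
  + 672 * (504 * (theta (sigma_gen n 1) * sigma_gen n 5))
  + 4032 * theta (theta (sigma_gen n 5)) - 3360 * theta (sigma_gen n 3)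
  - 1680 * (240 * theta (sigma_gen n 3 * sigma_gen n 3)))`_n = 0.
  apply: (zero_upto_eq _ _ _ (theta_E2_E6 n _ _ _ (theta_E2 n)
    (theta_E4 n) (theta_E6 n))).
  rewrite /E2 /E4 /E6 !thetaE; ring.
rewrite !(coefD, coefN, coef_natlM, coef_theta (_ * _)).
rewrite (coef_sigma_genM _ _ _ _ (leqnn n)) (sigma_conv33 n n0) !theta_gen.
rewrite (coef_genM _ _ _ _ (leqnn n)) !(coef_gen _ _ n);
  [|by rewrite n0 leqnn ..].
lra.
Qed.

(** The symmetric weight [m (n - m)] is the coefficient of the square of [theta E2]. *)
Lemma sum_mul_sigma11 n : (0 < n)%N ->
  \sum_(1 <= m < n) m%:R * (sigma 1 m)%:R * ((n - m)%:R * (sigma 1 (n - m))%:R) =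
  1 / 12 * (n%:R ^+ 2 * (sigma 3 n)%:R - n%:R ^+ 3 * (sigma 1 n)%:R) :> rat.
Proof.
move=> n0.
have : (2880 * (theta (sigma_gen n 1) * theta (sigma_gen n 1))
  + 240 * theta (theta (theta (sigma_gen n 1)))
  - 240 * theta (theta (sigma_gen n 3)))`_n = 0.
  apply: (zero_upto_eq _ _ _ (theta_E2_sq n _ _ _ (theta_E2 n)
    (theta_E4 n) (theta_E6 n))).
  rewrite /E2 /E4 /E6 !thetaE; ring.
rewrite !theta_gen !(coefD, coefN, coef_natlM).
rewrite (coef_genM _ _ _ _ (leqnn n)) !(coef_gen _ _ n);
  [|by rewrite n0 leqnn ..].
lra.
Qed.

(** Reverse the sum by [m |-> n - m] and add: the weights total [n]. *)
Lemma sum_id_sigma11 n :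
  2 * (\sum_(1 <= m < n) m%:R * (sigma 1 m)%:R * (sigma 1 (n - m))%:R) =
  n%:R * sigma_conv 1 1 n.
Proof.
rewrite mulr_natl mulr2n {2}big_nat_rev -big_split /sigma_conv mulr_sumr /=.
apply: eq_big_nat => m /andP[_ mn].
rewrite add1n subSS subKn ?natrB ?(ltnW mn) //; ring.
Qed.

(** This is [m ^ 2 = n m - m (n - m)]. *)
Lemma sum_sqr_sigma11 n :
  \sum_(1 <= m < n) m%:R ^+ 2 * (sigma 1 m)%:R * (sigma 1 (n - m))%:R =
  n%:R * (\sum_(1 <= m < n) m%:R * (sigma 1 m)%:R * (sigma 1 (n - m))%:R)
  - \sum_(1 <= m < n)
    m%:R * (sigma 1 m)%:R * ((n - m)%:R * (sigma 1 (n - m))%:R) :> rat.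
Proof.
rewrite mulr_sumr -sumrB; apply: eq_big_nat => m /andP[_ mn].
rewrite (natrB _ (ltnW mn)); ring.
Qed.

(** Reversal again, with [m ^ 3 + (n - m) ^ 3 = n ^ 3 - 3 n m (n - m)]. *)
Lemma sum_cube_sigma11 n :
  2 * (\sum_(1 <= m < n) m%:R ^+ 3 * (sigma 1 m)%:R * (sigma 1 (n - m))%:R) =
  n%:R ^+ 3 * sigma_conv 1 1 n
  - 3 * n%:R * (\sum_(1 <= m < n)
    m%:R * (sigma 1 m)%:R * ((n - m)%:R * (sigma 1 (n - m))%:R)).
Proof.
rewrite mulr_natl mulr2n {2}big_nat_rev -big_split /sigma_conv !mulr_sumr -sumrB /=.
apply: eq_big_nat => m /andP[_ mn].
rewrite add1n subSS subKn ?natrB ?(ltnW mn) //; ring.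
Qed.

Theorem theorem2p9 (n : nat) (hn : (1 <= n)%N) :
  (\sum_(1 <= m < n) m%:R ^+ 3 * (sigma 1 m)%:R * (sigma 1 (n - m))%:R
     = 1 / 12 * n%:R ^+ 3 * (sigma 3 n)%:R
       - 1 / 24 * n%:R ^+ 3 * (3 * n%:R - 1) * (sigma 1 n)%:R :> rat)
  /\
  (\sum_(1 <= m < n) m%:R ^+ 2 * (sigma 1 m)%:R * (sigma 1 (n - m))%:R
     = 1 / 8 * n%:R ^+ 2 * (sigma 3 n)%:R
       - 1 / 24 * n%:R ^+ 2 * (4 * n%:R - 1) * (sigma 1 n)%:R :> rat)
  /\
  (\sum_(1 <= m < n) m%:R * (sigma 1 m)%:R * (sigma 1 (n - m))%:R
     = 1 / 24 * n%:R * (1 - 6 * n%:R) * (sigma 1 n)%:R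
       + 5 / 24 * n%:R * (sigma 3 n)%:R :> rat)
  /\
  (\sum_(1 <= m < n) m%:R ^+ 2 * (sigma 1 m)%:R * (sigma 3 (n - m))%:R
     = - (1 / 240 * n%:R ^+ 2 * (sigma 1 n)%:R)
       - 1 / 120 * n%:R ^+ 3 * (sigma 3 n)%:R
       + 1 / 80 * n%:R ^+ 2 * (sigma 5 n)%:R :> rat)
  /\
  (\sum_(1 <= m < n) m%:R * (sigma 1 m)%:R * (sigma 3 (n - m))%:R
     = - (1 / 240 * n%:R * (sigma 1 n)%:R)
       - 1 / 40 * n%:R ^+ 2 * (sigma 3 n)%:R
       + 7 / 240 * n%:R * (sigma 5 n)%:R :> rat)
  /\
  (\sum_(1 <= m < n) m%:R * (sigma 1 m)%:R * (sigma 5 (n - m))%:R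
     = 1 / 504 * n%:R * (sigma 1 n)%:R
       - 1 / 84 * n%:R ^+ 2 * (sigma 5 n)%:R
       + 5 / 504 * n%:R * (sigma 7 n)%:R :> rat)
  /\
  (\sum_(1 <= m < n) (sigma 1 m)%:R * (sigma 5 (n - m))%:R
     = 1 / 504 * (sigma 1 n)%:R
       - 1 / 12 * n%:R * (sigma 5 n)%:R
       + 1 / 24 * (sigma 5 n)%:R
       + 5 / 126 * (sigma 7 n)%:R :> rat)
  /\
  (\sum_(1 <= m < n) (sigma 1 m)%:R * (sigma 7 (n - m))%:R
     = - (1 / 480 * (sigma 1 n)%:R)
       + 1 / 24 * (sigma 7 n)%:R
       + 11 / 480 * (sigma 9 n)%:R
       - 1 / 16 * n%:R * (sigma 7 n)%:R :> rat).
Proof.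
(* The first three identities need only the weights 1 and [m (n - m)]; the remaining five are linear
   rearrangements of sums already evaluated. *)
have h11 := sigma_conv11 n hn; have hM := sum_mul_sigma11 n hn.
have h1 : \sum_(1 <= m < n) m%:R * (sigma 1 m)%:R * (sigma 1 (n - m))%:R
    = 1 / 24 * n%:R * (1 - 6 * n%:R) * (sigma 1 n)%:R
      + 5 / 24 * n%:R * (sigma 3 n)%:R :> rat.
  have := sum_id_sigma11 n; rewrite h11; lra.
have h2 := sum_sqr_sigma11 n; rewrite h1 hM in h2.
have h3 := sum_cube_sigma11 n; rewrite h11 hM in h3.
have h13 := sum_id_sigma13 n hn; have h13' := sum_sqr_sigma13 n hn.
have h15 := sum_id_sigma15 n hn.
have h15' := sigma_conv15 n hn; have h17 := sigma_conv17 n hn.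
rewrite /sigma_conv in h15' h17.
do ![split]; lra.
Qed.
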